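(* Let $0<c_1<c_2<\infty$ and let $\epsilon>0$ be sufficiently small ($\epsilon\ll 1$ and $\epsilon\ll c_1$, i.e. $0<\epsilon\le\epsilon_0$ for some $\epsilon_0>0$ depending only on $c_1,c_2$). Suppose that $(a,\phi)$ and $(A,\varphi)$ are both admissible pairs for $(\epsilon,c_1,c_2)$ (in the sense of the context) and that $$a(t)\cos\phi(t)=A(t)\cos\varphi(t)\quad\text{for all }t\in\mathbb{R}.$$ For $m\in\mathbb{Z}$ define $t_m\in\mathbb{R}$ by $\phi(t_m)=(m+1/2)\pi$ and $s_m\in\mathbb{R}$ by $\phi(s_m)=m\pi$. Then, after adding a suitable constant integer multiple of $2\pi$ to $\varphi$, the functions $\alpha(t)=\varphi(t)-\phi(t)$ and $\beta(t)=A(t)-a(t)$ satisfy: $\alpha\in C^2(\mathbb{R})$, $\beta\in C^1(\mathbb{R})$, $\alpha(t_m)=0$ for all $m\in\mathbb{Z}$, $\beta(s_m)\ge 0$ for all $m\in\mathbb{Z}$, and $\beta(s_m)=0$ if and only if $\alpha(s_m)=0$. Moreover, for all $t\in\mathbb{R}$, $$|\alpha'(t)|\le 3\pi\epsilon,\qquad |\alpha(t)|\le\frac{4\pi^2\epsilon}{c_1},\qquad |\beta(t)|<3\pi\epsilon.$$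
   Context: A pair $(A,\phi)$ of functions $A,\phi:\mathbb{R}\to\mathbb{R}$ is called admissible for $(\epsilon,c_1,c_2)$ if - $A\in C^1(\mathbb{R})\cap L^\infty(\mathbb{R})$, $\inf_{t}A(t)>c_1$, $\sup_t A(t)<c_2$; - $\phi\in C^2(\mathbb{R})$, $\inf_t\phi'(t)>c_1$, $\sup_t\phi'(t)<c_2$; - $|A'(t)|\le\epsilon\phi'(t)$ and $|\phi''(t)|\le\epsilon\phi'(t)$ for all $t\in\mathbb{R}$. The class $\mathcal{A}^{c_1,c_2}_\epsilon$ of intrinsic mode functions consists of the functions $t\mapsto A(t)\cos\phi(t)$ with $(A,\phi)$ admissible; the two pairs in the claim are two representations in this class of the same function. *)

(* Defs.v *)
From Stdlib Require Import Reals ZArith Lra.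
From Coquelicot Require Import Coquelicot.
Open Scope R_scope.

Definition Ck (n : nat) (f : R -> R) : Prop :=
  (forall (k : nat) (t : R), (k <= n)%nat -> ex_derive_n f k t) /\
  (forall t : R, continuous (Derive_n f n) t).

(* Extended-real infimum and supremum of the values of [f]: the real-valued
   versions would be meaningless for an unbounded function. *)
Definition infR (f : R -> R) : Rbar := Glb_Rbar (fun y : R => exists t : R, y = f t).
Definition supR (f : R -> R) : Rbar := Lub_Rbar (fun y : R => exists t : R, y = f t).

(* L^infinity membership, used for continuous functions only, for which the
   essential supremum of |f| is its supremum. *)
Definition bounded (f : R -> R) : Prop := exists M : R, forall t : R, Rabs (f t) <= M.

Record admissible (eps c1 c2 : R) (A phi : R -> R) : Prop := {
  amp_C1 : Ck 1 A;
  amp_bounded : bounded A;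
  amp_inf : Rbar_lt c1 (infR A);
  amp_sup : Rbar_lt (supR A) c2;
  phase_C2 : Ck 2 phi;
  freq_inf : Rbar_lt c1 (infR (Derive phi));
  freq_sup : Rbar_lt (supR (Derive phi)) c2;
  amp_slow : forall t : R, Rabs (Derive A t) <= eps * Derive phi t;
  freq_slow : forall t : R, Rabs (Derive_n phi 2 t) <= eps * Derive phi t
}.

(* Main.v *)
(** The two phases [phi] and [psi] are increasing bijections onto the line and
    [cos phi], [cos psi] have the same zeros [t_m], so [psi - phi] is a constant
    multiple of [PI] on these zeros; comparing signs makes it a multiple of
    [2 * PI], and we may shift [psi] so that [alpha = psi - phi] vanishes at
    every [t_m].  By Rolle, [alpha'] vanishes somewhere on each [[t_m, t_(m+1)]].
    Since [|alpha''| <= eps * (phi' + psi')] and both phases grow by exactly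
    [PI] on this interval, [|alpha'| <= 2 * PI * eps]; integrating from [t_m]
    bounds [alpha].  At [s_m] the identity reads [a = A * cos alpha], whence
    [0 <= beta (s_m) <= A * alpha^2 / 2 = O(eps^2)], and
    [|beta'| <= eps * (phi' + psi')] spreads this bound to all points. *)
Require Import Defs.
From Stdlib Require Import Reals ZArith Lra Lia FunctionalExtensionality.
From Coquelicot Require Import Coquelicot.
Open Scope R_scope.

(** * Pointwise bounds, smoothness of differences, constant phase shifts *)

Lemma infR_gt (f : R -> R) (c t : R) : Rbar_lt c (infR f) -> c < f t.
Proof.
  intros H. apply (Rbar_lt_le_trans c (infR f) (f t) H).
  apply (proj1 (Glb_Rbar_correct (fun y => exists t, y = f t))).
  now exists t.
Qed.

Lemma supR_lt (f : R -> R) (c t : R) : Rbar_lt (supR f) c -> f t < c.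
Proof.
  intros H. apply (Rbar_le_lt_trans (f t) (supR f) c); [|exact H].
  apply (proj1 (Lub_Rbar_correct (fun y => exists t, y = f t))).
  now exists t.
Qed.

Lemma Ck_ex_derive_n (n k : nat) (f : R -> R) (x : R) :
  Ck n f -> (k <= n)%nat -> ex_derive_n f k x.
Proof. intros [H _] Hk. now apply H. Qed.

Lemma Ck_minus (n : nat) (f g : R -> R) :
  Ck n f -> Ck n g -> Ck n (fun x => f x - g x).
Proof.
  intros Hf Hg.
  (* Linearity of iterated derivatives requires all lower orders to exist in a neighbourhood; here
     they exist everywhere. *)
  assert (near : forall h, Ck n h -> forall k x, (k <= n)%nat ->
            locally x (fun y => forall j, (j <= k)%nat -> ex_derive_n h j y)).
  { intros h Hh k x Hk. apply filter_forall. intros y j Hj.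
    apply (Ck_ex_derive_n n); [exact Hh | lia]. }
  split.
  - intros k x Hk. now apply ex_derive_n_minus; apply near.
  - intros x.
    apply (continuous_ext (fun y => minus (Derive_n f n y) (Derive_n g n y))).
    + intros y. symmetry. now apply Derive_n_minus; apply near.
    + apply (continuous_minus (Derive_n f n) (Derive_n g n));
        [apply Hf | apply Hg].
Qed.

Lemma Derive_shift (f : R -> R) (c : R) : Derive (fun x => f x + c) = Derive f.
Proof.
  apply functional_extensionality. intros x. unfold Derive. f_equal.
  apply Lim_ext. intros h. f_equal. ring.
Qed.

Lemma Derive_n_shift (f : R -> R) (c : R) (n : nat) :
  Derive_n (fun x => f x + c) (S n) = Derive_n f (S n).
Proof.
  induction n as [|n IH].
  - apply Derive_shift.
  - change (Derive (Derive_n (fun x => f x + c) (S n)) = Derive (Derive_n f (S n))).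
    now rewrite IH.
Qed.

Lemma Ck_shift (n : nat) (f : R -> R) (c : R) :
  Ck (S n) f -> Ck (S n) (fun x => f x + c).
Proof.
  intros [H1 H2]. split.
  - intros [|[|k]] x Hk.
    + exact I.
    + apply @ex_derive_plus; [now apply (H1 1%nat) | apply ex_derive_const].
    + specialize (H1 (S (S k)) x Hk).
      change (ex_derive (Derive_n (fun x => f x + c) (S k)) x).
      now rewrite Derive_n_shift.
  - rewrite Derive_n_shift. exact H2.
Qed.

(** Lets the estimates be proved for phases already aligned at the [t m], then applied to the
    shifted [varphi]. *)
Lemma admissible_shift (eps c1 c2 c : R) (A phi : R -> R) :
  admissible eps c1 c2 A phi -> admissible eps c1 c2 A (fun x => phi x + c).
Proof.
  intros [H1 H2 H3 H4 H5 H6 H7 H8 H9].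
  constructor; rewrite ?Derive_n_shift, ?Derive_shift; auto.
  now apply Ck_shift.
Qed.

(** * Mean value comparisons *)

(** Both [g + f] and [g - f] have nonnegative derivative, hence are monotone. This replaces
    integrating the bound on the derivative of [f]. *)
Lemma increment_le (f g : R -> R) (x y : R) :
  (forall z, ex_derive f z) -> (forall z, ex_derive g z) ->
  (forall z, Rabs (Derive f z) <= Derive g z) ->
  x <= y -> Rabs (f y - f x) <= g y - g x.
Proof.
  intros Hf Hg Hle Hxy.
  assert (mono : forall h h', (forall z, is_derive h z (h' z)) ->
            (forall z, 0 <= h' z) -> h x <= h y).
  { intros h h' Hd Hp.
    destruct (MVT_gen h x y h') as [z [_ Hz]].
    - intros z _. apply Hd.
    - intros z _. apply continuity_pt_filterlim.
      apply (ex_derive_continuous h). eexists; apply Hd.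
    - specialize (Hp z). nra. }
  apply Rabs_le. split.
  - assert (H := mono (fun z => plus (g z) (f z)) (fun z => plus (Derive g z) (Derive f z))).
    enough (g x + f x <= g y + f y) by lra.
    apply H; intros z.
    + apply @is_derive_plus; now apply Derive_correct.
    + specialize (Hle z). apply Rabs_le_between in Hle.
      change (0 <= Derive g z + Derive f z). lra.
  - assert (H := mono (fun z => minus (g z) (f z)) (fun z => minus (Derive g z) (Derive f z))).
    enough (g x - f x <= g y - f y) by lra.
    apply H; intros z.
    + apply @is_derive_minus; now apply Derive_correct.
    + specialize (Hle z). apply Rabs_le_between in Hle.
      change (0 <= Derive g z - Derive f z). lra.
Qed.

Lemma lt_of_Derive_pos (f : R -> R) :
  (forall z, ex_derive f z) -> (forall z, 0 < Derive f z) ->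
  forall x y, x < y -> f x < f y.
Proof.
  intros Hf Hp x y Hxy.
  destruct (MVT_gen f x y (Derive f)) as [z [_ Hz]].
  - intros z _. now apply Derive_correct.
  - intros z _. apply continuity_pt_filterlim. now apply (ex_derive_continuous f).
  - specialize (Hp z). nra.
Qed.

(** * Trigonometric facts *)

Lemma cos_two_PI_Z (k : Z) : cos (IZR k * (2 * PI)) = 1.
Proof.
  replace (IZR k * (2 * PI)) with (2 * (IZR k * PI)) by ring.
  rewrite cos_2a_sin, (sin_eq_0_1 (IZR k * PI)) by now exists k.
  ring.
Qed.

(** The sign [cos (IZR k * PI)] is left unevaluated, which avoids splitting on the parity of [k]. *)
Lemma cos_add_Z_PI (k : Z) (x : R) : cos (IZR k * PI + x) = cos (IZR k * PI) * cos x.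
Proof. rewrite cos_plus, (sin_eq_0_1 (IZR k * PI)) by now exists k. ring. Qed.

Lemma cos_add_two_PI_Z (k : Z) (x : R) : cos (x + IZR k * (2 * PI)) = cos x.
Proof.
  replace (x + IZR k * (2 * PI)) with (IZR (2 * k) * PI + x)
    by (rewrite mult_IZR; ring).
  rewrite cos_add_Z_PI.
  replace (IZR (2 * k) * PI) with (IZR k * (2 * PI)) by (rewrite mult_IZR; ring).
  rewrite cos_two_PI_Z. ring.
Qed.

Lemma cos_Z_PI_neq_0 (k : Z) : cos (IZR k * PI) <> 0.
Proof.
  intros H. assert (E := sin2_cos2 (IZR k * PI)). unfold Rsqr in E.
  rewrite H, (sin_eq_0_1 (IZR k * PI)) in E by now exists k. lra.
Qed.

(** Subtracting [(m + 1) * PI] moves the argument strictly between [- PI / 2] and [PI / 2], where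
    the cosine is positive. *)
Lemma cos_neq_0_between (m : Z) (x : R) :
  (IZR m + 1 / 2) * PI < x < (IZR m + 3 / 2) * PI -> cos x <> 0.
Proof.
  intros [H1 H2]. replace x with (IZR (m + 1) * PI + (x - IZR (m + 1) * PI)) by ring.
  rewrite cos_add_Z_PI. apply Rmult_integral_contrapositive_currified.
  - apply cos_Z_PI_neq_0.
  - rewrite plus_IZR. apply Rgt_not_eq, cos_gt_0; lra.
Qed.

(** Half-angle formula: the left side is twice the square of [sin (x / 2)], and the sine is
    1-Lipschitz. *)
Lemma one_sub_cos_le (x : R) : 1 - cos x <= x ^ 2 / 2.
Proof.
  replace (cos x) with (cos (2 * (x / 2))) by (f_equal; field).
  rewrite cos_2a_sin.
  assert (H : Rabs (sin (x / 2)) <= Rabs (x / 2)).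
  { pose proof (increment_le sin id (Rmin 0 (x / 2)) (Rmax 0 (x / 2))) as H.
    assert (Hi : forall z, is_derive id z 1) by (intros; apply @is_derive_id).
    assert (H' : Rabs (sin (Rmax 0 (x / 2)) - sin (Rmin 0 (x / 2)))
                 <= Rmax 0 (x / 2) - Rmin 0 (x / 2)).
    { apply H.
      - intros z. eexists. apply is_derive_sin.
      - intros z. eexists. apply Hi.
      - intros z. rewrite (is_derive_unique _ _ _ (is_derive_sin z)),
          (is_derive_unique _ _ _ (Hi z)).
        apply Rabs_le, COS_bound.
      - apply Rle_trans with 0; [apply Rmin_l | apply Rmax_l]. }
    destruct (Rle_dec 0 (x / 2)).
    - rewrite Rmax_right, Rmin_left, sin_0 in H' by lra.
      rewrite (Rabs_pos_eq (x / 2)) by lra. now rewrite !Rminus_0_r in H'.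
    - rewrite Rmax_left, Rmin_right, sin_0 in H' by lra.
      rewrite (Rabs_left (x / 2)) by lra.
      unfold Rminus in H'. now rewrite !Rplus_0_l, Rabs_Ropp in H'. }
  apply Rsqr_le_abs_1 in H. unfold Rsqr in H. nra.
Qed.

(** * Monotonicity and growth of a single admissible phase *)

Section Admissible.

Variables (eps c1 c2 : R) (A phi : R -> R).
Hypothesis (hc1 : 0 < c1) (adm : admissible eps c1 c2 A phi).

Lemma amp_bounds (x : R) : c1 < A x < c2.
Proof.
  split; [apply infR_gt, (amp_inf _ _ _ _ _ adm) | apply supR_lt, (amp_sup _ _ _ _ _ adm)].
Qed.

Lemma freq_gt (x : R) : c1 < Derive phi x.
Proof. apply infR_gt, (freq_inf _ _ _ _ _ adm). Qed.

Lemma amp_ex_derive (x : R) : ex_derive A x.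
Proof. apply (Ck_ex_derive_n 1 1 A x (amp_C1 _ _ _ _ _ adm)). lia. Qed.

Lemma phase_ex_derive (x : R) : ex_derive phi x.
Proof. apply (Ck_ex_derive_n 2 1 phi x (phase_C2 _ _ _ _ _ adm)). lia. Qed.

Lemma freq_ex_derive (x : R) : ex_derive (Derive phi) x.
Proof. apply (Ck_ex_derive_n 2 2 phi x (phase_C2 _ _ _ _ _ adm)). lia. Qed.

Lemma phase_lt (x y : R) : x < y -> phi x < phi y.
Proof.
  apply lt_of_Derive_pos; [apply phase_ex_derive|].
  intros z. assert (H := freq_gt z). lra.
Qed.

Lemma phase_le (x y : R) : x <= y -> phi x <= phi y.
Proof. intros [H| ->]; [left; now apply phase_lt | right; reflexivity]. Qed.

Lemma phase_lt_inv (x y : R) : phi x < phi y -> x < y.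
Proof.
  intros H. destruct (Rlt_le_dec x y) as [|Hle]; [assumption|].
  apply phase_le in Hle. lra.
Qed.

Lemma phase_le_inv (x y : R) : phi x <= phi y -> x <= y.
Proof.
  intros H. destruct (Rle_lt_dec x y) as [|Hlt]; [assumption|].
  apply phase_lt in Hlt. lra.
Qed.

Lemma phase_growth (x y : R) : x <= y -> c1 * (y - x) <= phi y - phi x.
Proof.
  intros Hxy. destruct (MVT_gen phi x y (Derive phi)) as [z [_ Hz]].
  - intros z _. apply Derive_correct, phase_ex_derive.
  - intros z _. apply continuity_pt_filterlim.
    apply (ex_derive_continuous phi), phase_ex_derive.
  - assert (H := freq_gt z). nra.
Qed.

Lemma phase_IVT (x y v : R) :
  x <= y -> phi x < v < phi y -> exists z, phi z = v.
Proof.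
  intros Hxy Hv.
  destruct (IVT_gen phi x y v) as [z [_ Hz]].
  - intros z. apply continuity_pt_filterlim.
    apply (ex_derive_continuous phi), phase_ex_derive.
  - assert (H := phase_le x y Hxy).
    rewrite Rmin_left, Rmax_right by lra. lra.
  - now exists z.
Qed.

Lemma half_period_cover (t : Z -> R) (x : R) :
  (forall m, phi (t m) = (IZR m + 1 / 2) * PI) ->
  exists m, t m <= x <= t (m + 1)%Z.
Proof.
  intros Ht. assert (HPI := PI_RGT_0).
  destruct (archimed (phi x / PI - 1 / 2)) as [H1 H2].
  (* [up r] is the least integer strictly above [r], so [u - 1] is the floor of
     [phi x / PI - 1 / 2]. *)
  set (u := up (phi x / PI - 1 / 2)) in *.
  assert (E : phi x = phi x / PI * PI) by (field; lra).
  exists (u - 1)%Z. split; apply phase_le_inv; rewrite Ht, E.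
  - apply Rmult_le_compat_r; rewrite ?minus_IZR; lra.
  - apply Rmult_le_compat_r; rewrite ?plus_IZR, ?minus_IZR; lra.
Qed.

End Admissible.

(** * Aligning the phases of two representations *)

Section TwoRepresentations.

Variables (eps c1 c2 : R) (a phi A psi : R -> R) (t s : Z -> R).
Hypothesis (hc1 : 0 < c1).
Hypothesis (adm1 : admissible eps c1 c2 a phi).
Hypothesis (adm2 : admissible eps c1 c2 A psi).
Hypothesis (same : forall x, a x * cos (phi x) = A x * cos (psi x)).
Hypothesis (Ht : forall m, phi (t m) = (IZR m + 1 / 2) * PI).
Hypothesis (Hs : forall m, phi (s m) = IZR m * PI).

Lemma amps_pos (x : R) : 0 < a x /\ 0 < A x.
Proof.
  assert (H1 := amp_bounds _ _ _ _ _ adm1 x).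
  assert (H2 := amp_bounds _ _ _ _ _ adm2 x). lra.
Qed.

Lemma cos_phases_0 (x : R) : cos (phi x) = 0 <-> cos (psi x) = 0.
Proof.
  assert (H := same x). destruct (amps_pos x).
  split; intros E; rewrite E, Rmult_0_r in H.
  - symmetry in H. apply Rmult_integral in H. lra.
  - apply Rmult_integral in H. lra.
Qed.

Lemma cos_zero_eq (m : Z) : cos ((IZR m + 1 / 2) * PI) = 0.
Proof. apply cos_eq_0_1. exists m. field. Qed.

Lemma t_lt_succ (m : Z) : t m < t (m + 1)%Z.
Proof.
  apply (phase_lt_inv _ _ _ _ _ hc1 adm1). rewrite !Ht, plus_IZR.
  assert (H := PI_RGT_0). lra.
Qed.

(** The index is shifted: [(m + 1) * PI] is the midpoint of the values of [phi] at [t m] and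
    [t (m + 1)]. *)
Lemma s_between (m : Z) : t m < s (m + 1)%Z < t (m + 1)%Z.
Proof.
  assert (H := PI_RGT_0).
  split; apply (phase_lt_inv _ _ _ _ _ hc1 adm1); rewrite Ht, Hs, !plus_IZR; lra.
Qed.

(* If [psi] gained [2 * PI] or more, an intermediate value of [psi] would give
   a zero of [cos phi] strictly between two consecutive ones. *)
Lemma psi_step (m : Z) : psi (t (m + 1)%Z) = psi (t m) + PI.
Proof.
  assert (HPI := PI_RGT_0).
  assert (Hz : forall n, exists k, psi (t n) = (IZR k + 1 / 2) * PI).
  { intros n. destruct (cos_eq_0_0 (psi (t n))) as [k Hk].
    - apply cos_phases_0. rewrite Ht. apply cos_zero_eq.
    - exists k. rewrite Hk. field. }
  destruct (Hz m) as [k Hk]. destruct (Hz (m + 1)%Z) as [l Hl].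
  assert (Hlt := t_lt_succ m).
  assert (Hpsi := phase_lt _ _ _ _ _ hc1 adm2 _ _ Hlt).
  assert (Hkl : (k < l)%Z).
  { apply lt_IZR. rewrite Hk, Hl in Hpsi. nra. }
  destruct (Z.eq_dec l (k + 1)) as [->|Hne].
  { rewrite Hk, Hl, plus_IZR. ring. }
  exfalso.
  assert (Hkl2 : IZR k + 2 <= IZR l) by (rewrite <- plus_IZR; apply IZR_le; lia).
  destruct (phase_IVT _ _ _ _ _ hc1 adm2 (t m) (t (m + 1)%Z) ((IZR (k + 1) + 1 / 2) * PI))
    as [z Hz'].
  - lra.
  - rewrite Hk, Hl, plus_IZR. nra.
  - assert (E : cos (phi z) = 0) by (apply cos_phases_0; rewrite Hz'; apply cos_zero_eq).
    (* Monotonicity of [psi] places [z] strictly between the two zeros; monotonicity of [phi] then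
       places [phi z] between consecutive zeros of the cosine. *)
    revert E. apply (cos_neq_0_between m). split.
    + rewrite <- Ht. apply (phase_lt _ _ _ _ _ hc1 adm1).
      apply (phase_lt_inv _ _ _ _ _ hc1 adm2). rewrite Hz', Hk, plus_IZR. nra.
    + replace (IZR m + 3 / 2) with (IZR (m + 1) + 1 / 2) by (rewrite plus_IZR; field).
      rewrite <- Ht. apply (phase_lt _ _ _ _ _ hc1 adm1).
      apply (phase_lt_inv _ _ _ _ _ hc1 adm2). rewrite Hz', Hl, plus_IZR. nra.
Qed.

Lemma phase_difference_at_zeros :
  exists k : Z, forall m, psi (t m) + IZR k * (2 * PI) = phi (t m).
Proof.
  assert (HPI := PI_RGT_0).
  assert (H0 : cos (psi (t 0%Z)) = 0).
  { apply cos_phases_0. rewrite Ht. apply cos_zero_eq. }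
  apply cos_eq_0_0 in H0. destruct H0 as [k Hk].
  (* Since [psi] and [phi] both gain [PI] per step, the offset found at [t 0] propagates in both
     directions. *)
  assert (Hall : forall m, psi (t m) = (IZR m + 1 / 2) * PI + IZR k * PI).
  { apply Z.bi_induction.
    - intros ? ? ->. tauto.
    - rewrite Hk. field.
    - intros m. replace (Z.succ m) with (m + 1)%Z by lia.
      rewrite psi_step, plus_IZR. split; intros E; lra. }
  destruct (Z.Even_or_Odd k) as [[j Hj]|[j Hj]].
  - exists (- j)%Z. intros m. rewrite Hall, Ht, Hj, opp_IZR, mult_IZR. ring.
  - (* [cos phi = 1] and [cos psi < 0] at [s_0] if [k] is odd. *)
    exfalso. destruct (s_between (-1)) as [Hl Hr]. simpl in Hl, Hr.
    apply (phase_lt _ _ _ _ _ hc1 adm2) in Hl.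
    apply (phase_lt _ _ _ _ _ hc1 adm2) in Hr.
    rewrite Hall in Hl, Hr. simpl in Hl, Hr.
    assert (E := same (s 0%Z)). rewrite Hs, Rmult_0_l, cos_0 in E.
    destruct (amps_pos (s 0%Z)) as [Ha HA].
    set (y := psi (s 0%Z) - IZR k * PI).
    (* Between the neighbouring zeros, [psi] takes values within [PI / 2] of [IZR k * PI]. *)
    assert (Hy : 0 < cos y) by (apply cos_gt_0; unfold y; lra).
    replace (psi (s 0%Z)) with (y + PI + IZR j * (2 * PI)) in E
      by (unfold y; rewrite Hj, plus_IZR, mult_IZR; ring).
    rewrite cos_add_two_PI_Z, neg_cos in E. nra.
Qed.

(** * Estimates for aligned phases *)

Hypothesis (aligned : forall m, psi (t m) = phi (t m)).

Lemma alpha_ex_derive (x : R) : ex_derive (fun x => psi x - phi x) x.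
Proof.
  apply @ex_derive_minus;
    [apply (phase_ex_derive _ _ _ _ _ adm2) | apply (phase_ex_derive _ _ _ _ _ adm1)].
Qed.

Lemma Derive_alpha :
  Derive (fun x => psi x - phi x) = (fun x => Derive psi x - Derive phi x).
Proof.
  apply functional_extensionality. intros x. apply Derive_minus;
    [apply (phase_ex_derive _ _ _ _ _ adm2) | apply (phase_ex_derive _ _ _ _ _ adm1)].
Qed.

(** [eps * (phi + psi)] is the common majorant: its derivative dominates both the second derivative
    of [psi - phi] and the first derivative of [A - a]. *)
Lemma phase_sum_ex_derive (x : R) : ex_derive (fun x => eps * (phi x + psi x)) x.
Proof.
  apply ex_derive_scal, @ex_derive_plus;
    [apply (phase_ex_derive _ _ _ _ _ adm1) | apply (phase_ex_derive _ _ _ _ _ adm2)].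
Qed.

Lemma Derive_phase_sum (x : R) :
  Derive (fun x => eps * (phi x + psi x)) x = eps * (Derive phi x + Derive psi x).
Proof.
  rewrite Derive_scal, Derive_plus; [reflexivity | |];
    [apply (phase_ex_derive _ _ _ _ _ adm1) | apply (phase_ex_derive _ _ _ _ _ adm2)].
Qed.

Lemma alpha'_increment (x y : R) : x <= y ->
  Rabs (Derive (fun x => psi x - phi x) y - Derive (fun x => psi x - phi x) x)
  <= eps * (phi y + psi y) - eps * (phi x + psi x).
Proof.
  rewrite Derive_alpha.
  apply (increment_le (fun x => Derive psi x - Derive phi x) (fun x => eps * (phi x + psi x))).
  - intros z. apply @ex_derive_minus;
      [apply (freq_ex_derive _ _ _ _ _ adm2) | apply (freq_ex_derive _ _ _ _ _ adm1)].
  - apply phase_sum_ex_derive.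
  - intros z. rewrite Derive_phase_sum, Derive_minus;
      [| apply (freq_ex_derive _ _ _ _ _ adm2) | apply (freq_ex_derive _ _ _ _ _ adm1)].
    assert (H1 := freq_slow _ _ _ _ _ adm1 z).
    assert (H2 := freq_slow _ _ _ _ _ adm2 z).
    change (Derive_n phi 2 z) with (Derive (Derive phi) z) in H1.
    change (Derive_n psi 2 z) with (Derive (Derive psi) z) in H2.
    apply Rabs_le_between in H1, H2. apply Rabs_le.
    change (fun x => Derive phi x) with (Derive phi).
    change (fun x => Derive psi x) with (Derive psi). lra.
Qed.

Lemma beta_increment (x y : R) : x <= y ->
  Rabs ((A y - a y) - (A x - a x)) <= eps * (phi y + psi y) - eps * (phi x + psi x).
Proof.
  apply (increment_le (fun x => A x - a x) (fun x => eps * (phi x + psi x))).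
  - intros z. apply @ex_derive_minus;
      [apply (amp_ex_derive _ _ _ _ _ adm2) | apply (amp_ex_derive _ _ _ _ _ adm1)].
  - apply phase_sum_ex_derive.
  - intros z. rewrite Derive_phase_sum, Derive_minus;
      [| apply (amp_ex_derive _ _ _ _ _ adm2) | apply (amp_ex_derive _ _ _ _ _ adm1)].
    assert (H1 := amp_slow _ _ _ _ _ adm1 z).
    assert (H2 := amp_slow _ _ _ _ _ adm2 z).
    apply Rabs_le_between in H1, H2. apply Rabs_le. lra.
Qed.

Hypothesis (heps : 0 < eps).

Lemma Rabs_alpha'_le (x : R) :
  Rabs (Derive (fun x => psi x - phi x) x) <= 2 * PI * eps.
Proof.
  destruct (half_period_cover _ _ _ _ _ hc1 adm1 t x Ht) as [m [Hl Hr]].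
  assert (Hlt := t_lt_succ m).
  (* Rolle: [psi - phi] vanishes at both endpoints, so its derivative vanishes at some [z]. *)
  destruct (MVT_gen (fun x => psi x - phi x) (t m) (t (m + 1)%Z)
              (Derive (fun x => psi x - phi x))) as [z [Hz E]].
  - intros z _. apply Derive_correct, alpha_ex_derive.
  - intros z _. apply continuity_pt_filterlim.
    apply (ex_derive_continuous (fun x => psi x - phi x)), alpha_ex_derive.
  - rewrite Rmin_left, Rmax_right in Hz by lra. destruct Hz as [Hz1 Hz2].
    rewrite !aligned in E.
    assert (E0 : Derive (fun x => psi x - phi x) z = 0).
    { apply (Rmult_eq_reg_r (t (m + 1)%Z - t m)); lra. }
    pose proof (phase_le _ _ _ _ _ hc1 adm1) as P1.
    pose proof (phase_le _ _ _ _ _ hc1 adm2) as P2.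
    pose proof (P1 _ _ Hl). pose proof (P1 _ _ Hr).
    pose proof (P1 _ _ Hz1). pose proof (P1 _ _ Hz2).
    pose proof (P2 _ _ Hl). pose proof (P2 _ _ Hr).
    pose proof (P2 _ _ Hz1). pose proof (P2 _ _ Hz2).
    rewrite !aligned, !Ht, ?plus_IZR in *.
    (* [x] and [z] lie in the same half period, over which [phi] and [psi] each vary by at most
       [PI]. *)
    destruct (Rle_dec z x) as [Hzx|Hzx].
    + assert (B := alpha'_increment z x Hzx).
      rewrite E0, Rminus_0_r in B. nra.
    + assert (B := alpha'_increment x z ltac:(lra)).
      rewrite E0, Rabs_minus_sym, Rminus_0_r in B. nra.
Qed.

Lemma Rabs_alpha_le (x : R) : Rabs (psi x - phi x) <= 2 * PI ^ 2 * eps / c1.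
Proof.
  assert (HPI := PI_RGT_0).
  destruct (half_period_cover _ _ _ _ _ hc1 adm1 t x Ht) as [m [Hl Hr]].
  assert (G := phase_growth _ _ _ _ _ adm1 _ _ Hl).
  assert (M := phase_le _ _ _ _ _ hc1 adm1 _ _ Hr).
  rewrite Ht, plus_IZR in M. rewrite Ht in G.
  (* On a half period [phi] rises by only [PI], at a rate above [c1]. *)
  assert (Hd : x - t m <= PI / c1).
  { apply (Rmult_le_reg_l c1); [assumption|].
    replace (c1 * (PI / c1)) with PI by (field; lra). lra. }
  assert (Hlin : forall z, is_derive (fun u => 2 * PI * eps * u) z (2 * PI * eps)).
  { intros z. auto_derive; [exact I | ring]. }
  assert (B := increment_le (fun x => psi x - phi x) (fun u => 2 * PI * eps * u) (t m) x
                 alpha_ex_derive (fun z => ex_intro _ _ (Hlin z))).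
  assert (B' : Rabs (psi x - phi x - (psi (t m) - phi (t m)))
               <= 2 * PI * eps * x - 2 * PI * eps * t m).
  { apply B; [|exact Hl]. intros z.
    replace (Derive (fun u => 2 * PI * eps * u) z) with (2 * PI * eps)
      by (symmetry; apply is_derive_unique, Hlin).
    apply Rabs_alpha'_le. }
  rewrite aligned, Rminus_diag, Rminus_0_r in B'.
  apply (Rle_trans _ _ _ B').
  replace (2 * PI ^ 2 * eps / c1) with (2 * PI * eps * (PI / c1)) by (field; lra).
  rewrite <- Rmult_minus_distr_l. apply Rmult_le_compat_l; [|exact Hd].
  apply Rmult_le_pos; lra.
Qed.

(** At [s m] the cosine of [phi] is the nonzero factor [cos (IZR m * PI)], which also splits off
    from [cos (psi (s m))] and cancels. *)
Lemma amp_at_s (m : Z) : a (s m) = A (s m) * cos (psi (s m) - phi (s m)).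
Proof.
  assert (E := same (s m)).
  replace (psi (s m)) with (IZR m * PI + (psi (s m) - phi (s m))) in E
    by (rewrite Hs; ring).
  rewrite cos_add_Z_PI, Hs in E. rewrite Hs.
  apply (Rmult_eq_reg_r (cos (IZR m * PI))); [lra | apply cos_Z_PI_neq_0].
Qed.

Lemma beta_s_nonneg (m : Z) : 0 <= A (s m) - a (s m).
Proof.
  rewrite amp_at_s. destruct (amps_pos (s m)).
  assert (H1 := COS_bound (psi (s m) - phi (s m))). nra.
Qed.

Lemma beta_s_eq_0 (m : Z) :
  A (s m) - a (s m) = 0 <-> psi (s m) - phi (s m) = 0.
Proof.
  assert (HPI := PI_RGT_0). rewrite amp_at_s.
  destruct (amps_pos (s m)) as [_ HA]. split; intros E.
  - assert (C : cos (psi (s m) - phi (s m)) = 1).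
    { apply (Rmult_eq_reg_l (A (s m))); lra. }
    destruct (s_between (m - 1)) as [Hl Hr].
    replace (m - 1 + 1)%Z with m in Hl, Hr by lia.
    apply (phase_lt _ _ _ _ _ hc1 adm2) in Hl, Hr.
    rewrite aligned, Ht in Hl, Hr. rewrite minus_IZR in Hl.
    assert (S0 : sin (psi (s m) - phi (s m)) = 0).
    { assert (S := sin2_cos2 (psi (s m) - phi (s m))). rewrite C, Rsqr_1 in S.
      apply Rsqr_0_uniq. lra. }
    apply sin_eq_0_0 in S0. destruct S0 as [j Hj].
    assert (j = 0%Z) as ->; [|lra].
    (* The neighbouring zeros confine [psi (s m)] to within [PI / 2] of [IZR m * PI], so no nonzero
       multiple of [PI] is possible. *)
    enough (-1 < j < 1)%Z by lia. rewrite Hs in Hj.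
    split; apply lt_IZR, (Rmult_lt_reg_r PI); lra.
  - rewrite E, cos_0. ring.
Qed.

(** The budget [3 * PI * eps] is split evenly between the value at the midpoint [u] and the
    increment from [u] to [x]. The first half is second order in [eps], and its strictness makes the
    conclusion strict. *)
Lemma Rabs_beta_lt (x : R) :
  c2 * (2 * PI ^ 2 * eps / c1) ^ 2 / 2 < 3 / 2 * (PI * eps) ->
  Rabs (A x - a x) < 3 * PI * eps.
Proof.
  intros Hsmall.
  destruct (half_period_cover _ _ _ _ _ hc1 adm1 t x Ht) as [m [Hl Hr]].
  destruct (s_between m) as [Sl Sr]. set (u := s (m + 1)%Z) in *.
  assert (Bs : Rabs (A u - a u) < 3 / 2 * (PI * eps)).
  { rewrite (Rabs_pos_eq (A u - a u)) by apply beta_s_nonneg.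
    assert (Hal := Rabs_alpha_le u).
    rewrite <- (Rabs_pos_eq (2 * PI ^ 2 * eps / c1)) in Hal
      by apply (Rle_trans _ _ _ (Rabs_pos _) Hal).
    apply Rsqr_le_abs_1 in Hal. rewrite !Rsqr_pow2 in Hal.
    assert (C := one_sub_cos_le (psi u - phi u)).
    assert (HA := amp_bounds _ _ _ _ _ adm2 u).
    apply Rle_lt_trans with (2 := Hsmall).
    unfold u. rewrite amp_at_s. fold u.
    apply Rle_trans with (A u * ((2 * PI ^ 2 * eps / c1) ^ 2 / 2)).
    - rewrite <- (Rmult_1_r (A u)) at 1. rewrite <- Rmult_minus_distr_l.
      apply Rmult_le_compat_l; lra.
    - assert (H := pow2_ge_0 (2 * PI ^ 2 * eps / c1)).
      set (q := (2 * PI ^ 2 * eps / c1) ^ 2) in *. nra. }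
  (* From [u], [phi] varies by at most [PI / 2], because [phi u] is the midpoint of its range, while
     [psi] is only known to vary by at most [PI]. *)
  assert (Bx : Rabs ((A x - a x) - (A u - a u)) <= 3 / 2 * (PI * eps)).
  { assert (Eu : phi u = (IZR m + 1) * PI) by (unfold u; rewrite Hs, plus_IZR; reflexivity).
    pose proof (phase_le _ _ _ _ _ hc1 adm1) as P1.
    pose proof (phase_le _ _ _ _ _ hc1 adm2) as P2.
    pose proof (P1 _ _ Hl). pose proof (P1 _ _ Hr).
    pose proof (P2 _ _ Hl). pose proof (P2 _ _ Hr).
    pose proof (P2 _ _ (Rlt_le _ _ Sl)). pose proof (P2 _ _ (Rlt_le _ _ Sr)).
    rewrite !aligned, !Ht, ?plus_IZR in *.
    destruct (Rle_dec u x) as [Hux|Hux].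
    - assert (B := beta_increment u x Hux). nra.
    - assert (B := beta_increment x u ltac:(lra)).
      rewrite Rabs_minus_sym in B. nra. }
  apply Rabs_def2 in Bs. apply Rabs_le_between in Bx. apply Rabs_def1; lra.
Qed.

End TwoRepresentations.


Theorem theorem2p1 (c1 c2 : R) (hc1 : 0 < c1) (hc12 : c1 < c2) :
  exists eps0 : R, 0 < eps0 /\
  forall eps : R, 0 < eps -> eps <= eps0 ->
  forall a phi A varphi : R -> R,
    admissible eps c1 c2 a phi ->
    admissible eps c1 c2 A varphi ->
    (forall x : R, a x * cos (phi x) = A x * cos (varphi x)) ->
  forall t s : Z -> R,
    (forall m : Z, phi (t m) = (IZR m + 1 / 2) * PI) ->
    (forall m : Z, phi (s m) = IZR m * PI) ->
  exists k : Z,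
    let alpha := fun x : R => (varphi x + IZR k * (2 * PI)) - phi x in
    let beta := fun x : R => A x - a x in
    Ck 2 alpha /\
    Ck 1 beta /\
    (forall m : Z, alpha (t m) = 0) /\
    (forall m : Z, 0 <= beta (s m)) /\
    (forall m : Z, beta (s m) = 0 <-> alpha (s m) = 0) /\
    (forall x : R, Rabs (Derive alpha x) <= 3 * PI * eps) /\
    (forall x : R, Rabs (alpha x) <= 4 * PI ^ 2 * eps / c1) /\
    (forall x : R, Rabs (beta x) < 3 * PI * eps).
Proof.
  assert (HPI := PI_RGT_0).
  (* At this value of [eps] the quadratic bound [c2 * (2 * PI ^ 2 * eps / c1) ^ 2 / 2] on the
     amplitude gap at [s m] equals [PI * eps]. *)
  exists (c1 ^ 2 / (2 * c2 * PI ^ 3)). split.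
  { apply Rdiv_lt_0_compat; [now apply pow_lt|].
    apply Rmult_lt_0_compat; [lra | now apply pow_lt]. }
  intros eps heps hle.
  assert (Hpe : 0 < PI * eps) by now apply Rmult_lt_0_compat.
  intros a phi A varphi adm1 adm2 same t s Ht Hs.
  destruct (phase_difference_at_zeros eps c1 c2 a phi A varphi t s)
    as [k Hk]; try assumption.
  exists k. intros alpha beta.
  (* From here the shifted phase plays the role of [psi], and [Hk] supplies [aligned]. *)
  assert (adm3 := admissible_shift _ _ _ (IZR k * (2 * PI)) _ _ adm2).
  assert (same3 : forall x, a x * cos (phi x) = A x * cos (varphi x + IZR k * (2 * PI))).
  { intros x. rewrite cos_add_two_PI_Z. apply same. }
  split; [|split; [|split; [|split; [|split; [|split; [|split]]]]]].
  - apply Ck_minus; [apply (phase_C2 _ _ _ _ _ adm3) | apply (phase_C2 _ _ _ _ _ adm1)].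
  - apply Ck_minus; [apply (amp_C1 _ _ _ _ _ adm3) | apply (amp_C1 _ _ _ _ _ adm1)].
  - intros m. unfold alpha. rewrite Hk. ring.
  - intros m. now apply (beta_s_nonneg eps c1 c2 a phi A _ s hc1 adm1 adm3).
  - intros m. now apply (beta_s_eq_0 eps c1 c2 a phi A _ t s hc1 adm1 adm3).
  - intros x.
    assert (H := Rabs_alpha'_le eps c1 c2 a phi A _ t hc1 adm1 adm3 Ht Hk heps x).
    apply (Rle_trans _ _ _ H). lra.
  - intros x.
    assert (H := Rabs_alpha_le eps c1 c2 a phi A _ t hc1 adm1 adm3 Ht Hk heps x).
    apply (Rle_trans _ _ _ H). apply Rmult_le_compat_r.
    + left. now apply Rinv_0_lt_compat.
    + assert (0 < PI ^ 2) by now apply pow_lt. nra.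
  - intros x. apply (Rabs_beta_lt eps c1 c2 a phi A _ t s hc1 adm1 adm3); try assumption.
    (* The choice of [eps0] makes the left-hand side at most [PI * eps]. *)
    apply Rle_lt_trans with (PI * eps); [|lra].
    replace (c2 * (2 * PI ^ 2 * eps / c1) ^ 2 / 2)
      with (PI * eps * (eps / (c1 ^ 2 / (2 * c2 * PI ^ 3)))) by (field; lra).
    rewrite <- (Rmult_1_r (PI * eps)) at 2. apply Rmult_le_compat_l; [lra|].
    apply Rle_div_l; [|now rewrite Rmult_1_l].
    apply Rdiv_lt_0_compat; [now apply pow_lt|].
    apply Rmult_lt_0_compat; [lra | now apply pow_lt].
Qed.
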